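(* Let $(L,[\cdot,\cdot]_t^1,[\cdot,\cdot,\cdot]_t^1,[\cdot,\cdot]_t^2,[\cdot,\cdot,\cdot]_t^2)$ be an infinitesimal deformation of a compatible Lie Yamaguti algebra $(L,[\cdot,\cdot]_1,[\cdot,\cdot,\cdot]_1,[\cdot,\cdot]_2,[\cdot,\cdot,\cdot]_2)$ generated by $(\mu_1,\lambda_1,\mu_2,\lambda_2)$. Then $\big((\mu_1,\lambda_1),(\mu_2,\lambda_2)\big)\in\mathfrak{C}_c^2(L,L)$ is a $(2\text{-}3)$-cocycle for $(L,[\cdot,\cdot]_1,[\cdot,\cdot,\cdot]_1,[\cdot,\cdot]_2,[\cdot,\cdot,\cdot]_2)$, i.e. $\delta_c\big((\mu_1,\lambda_1),(\mu_2,\lambda_2)\big)=0$.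
   Context: All vector spaces are over a field $\mathbb{K}$ of characteristic $0$. A Lie Yamaguti algebra is a vector space $L$ with a bilinear bracket $[\cdot,\cdot]:\wedge^2L\to L$ and a trilinear bracket $[\cdot,\cdot,\cdot]:\wedge^2L\otimes L\to L$ such that for all $x,y,z,w,t\in L$: (LY1) $[[x,y],z]+[[y,z],x]+[[z,x],y]+[x,y,z]+[y,z,x]+[z,x,y]=0$; (LY2) $[[x,y],z,w]+[[y,z],x,w]+[[z,x],y,w]=0$; (LY3) $[x,y,[z,w]]=[[x,y,z],w]+[z,[x,y,w]]$; (LY4) $[x,y,[z,w,t]]=[[x,y,z],w,t]+[z,[x,y,w],t]+[z,w,[x,y,t]]$. A compatible Lie Yamaguti algebra is a 5-tuple $(L,[\cdot,\cdot]_1,[\cdot,\cdot,\cdot]_1,[\cdot,\cdot]_2,[\cdot,\cdot,\cdot]_2)$ such that $(L,[\cdot,\cdot]_i,[\cdot,\cdot,\cdot]_i)$, $i=1,2$, are Lie Yamaguti algebras and, for all $x,y,z,t,a,b\in L$ (c.p. = the remaining cyclic permutations in $x,y,z$): (CY1) $[[x,y]_1,z]_2+c.p.+[[x,y]_2,z]_1+c.p.=0$; (CY2) $[[x,y]_1,z,t]_2+[[y,z]_1,x,t]_2+[[z,x]_1,y,t]_2+[[x,y]_2,z,t]_1+[[y,z]_2,x,t]_1+[[z,x]_2,y,t]_1=0$; (CY3) $[a,b,[x,y,z]_1]_2+[a,b,[x,y,z]_2]_1=[[a,b,x]_1,y,z]_2+[x,[a,b,y]_1,z]_2+[x,y,[a,b,z]_1]_2+[[a,b,x]_2,y,z]_1+[x,[a,b,y]_2,z]_1+[x,y,[a,b,z]_2]_1$;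 (CY4) $[a,b,[x,y]_1]_2+[a,b,[x,y]_2]_1=[[a,b,x]_1,y]_2+[x,[a,b,y]_1]_2+[[a,b,x]_2,y]_1+[x,[a,b,y]_2]_1$. Infinitesimal deformation: given bilinear maps $\mu_i:L\times L\to L$ and trilinear maps $\lambda_i:L\times L\times L\to L$, $i\in\{1,2\}$, put $[x,y]_t^i=[x,y]_i+t\mu_i(x,y)$ and $[x,y,z]_t^i=[x,y,z]_i+t\lambda_i(x,y,z)$. If for every $t\in\mathbb{K}$ the tuple $(L,[\cdot,\cdot]_t^1,[\cdot,\cdot,\cdot]_t^1,[\cdot,\cdot]_t^2,[\cdot,\cdot,\cdot]_t^2)$ is a compatible Lie Yamaguti algebra, one says that $(\mu_1,\lambda_1,\mu_2,\lambda_2)$ generates an infinitesimal deformation of $(L,[\cdot,\cdot]_1,[\cdot,\cdot,\cdot]_1,[\cdot,\cdot]_2,[\cdot,\cdot,\cdot]_2)$. Cochains and coboundary: $\mathfrak{C}^p(L,L)=\mathrm{Hom}((\wedge^2L)^{\otimes p},L)\oplus\mathrm{Hom}((\wedge^2L)^{\otimes p}\otimes L,L)$ for $p\ge1$. For $P=(P_1,P_2),Q=(Q_1,Q_2)\in\mathfrak{C}^1(L,L)$ the bracket is $[P,Q]_{\mathrm{LieY}}=P\circ Q+Q\circ P\in\mathfrak{C}^2(L,L)$, where, for $X_i=x_i\wedge y_i\in\wedge^2L$ and $x\in L$, $$(P\circ Q)_1(X_1,X_2)=-P_2(X_1,Q_1(X_2))+P_1(x_2\wedge Q_2(X_1,y_2))+P_1(Q_2(X_1,x_2)\wedge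 y_2),$$ $$(P\circ Q)_2(X_1,X_2,x)=-P_2(X_1,Q_2(X_2,x))+P_2(X_2,Q_2(X_1,x))+P_2(x_2\wedge Q_2(X_1,y_2),x)+P_2(Q_2(X_1,x_2)\wedge y_2,x).$$ Let $\Pi_i=(\pi_i,\omega_i)$ with $\pi_i=[\cdot,\cdot]_i$, $\omega_i=[\cdot,\cdot,\cdot]_i$. Here $\mathfrak{C}_c^2(L,L)=\mathfrak{C}^1(L,L)\oplus\mathfrak{C}^1(L,L)$ and, for $(F_1,F_2)\in\mathfrak{C}_c^2(L,L)$, $$\delta_c(F_1,F_2)=\big([\Pi_1,F_1]_{\mathrm{LieY}},\ [\Pi_2,F_1]_{\mathrm{LieY}}+[\Pi_1,F_2]_{\mathrm{LieY}},\ [\Pi_2,F_2]_{\mathrm{LieY}}\big).$$ A $(2\text{-}3)$-cocycle is an element of $\mathfrak{C}_c^2(L,L)$ annihilated by $\delta_c$. *)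

(* Defs.v *)
From mathcomp Require Import all_boot all_algebra.

Set Implicit Arguments.
Unset Strict Implicit.
Unset Printing Implicit Defensive.

Import GRing.Theory.
Local Open Scope ring_scope.

Section LieYamaguti.
Variables (K : fieldType) (L : lmodType K).

Definition bilinear_map (f : L -> L -> L) : Prop :=
  (forall y, linear (f^~ y)) /\ (forall x, linear (f x)).

Definition trilinear_map (f : L -> L -> L -> L) : Prop :=
  [/\ forall y z, linear (fun x => f x y z),
      forall x z, linear (fun y => f x y z)
    & forall x y, linear (f x y)].

(* Linear maps out of tensor and exterior products are represented by the
   corresponding multilinear maps, alternating in each exterior square: an
   element x /\ y of the exterior square of L becomes two consecutive
   arguments x and y. The carriers below hold arbitrary functions; in_C1 and
   in_C2 cut out Hom(W, L) (+) Hom(W (x) L, L) and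
   Hom(W (x) W, L) (+) Hom(W (x) W (x) L, L), where W is the exterior square
   of L. *)
Definition maps1 : Type := ((L -> L -> L) * (L -> L -> L -> L))%type.
Definition maps2 : Type :=
  ((L -> L -> L -> L -> L) * (L -> L -> L -> L -> L -> L))%type.

Definition in_C1 (P : maps1) : Prop :=
  [/\ bilinear_map P.1, forall x, P.1 x x = 0,
      trilinear_map P.2 & forall x z, P.2 x x z = 0].

Definition in_C2 (G : maps2) : Prop :=
  [/\ [/\ forall y1 x2 y2, linear (fun x1 => G.1 x1 y1 x2 y2),
          forall x1 x2 y2, linear (fun y1 => G.1 x1 y1 x2 y2),
          forall x1 y1 y2, linear (fun x2 => G.1 x1 y1 x2 y2)
        & forall x1 y1 x2, linear (fun y2 => G.1 x1 y1 x2 y2)],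
      (forall x x2 y2, G.1 x x x2 y2 = 0) /\
      (forall x1 y1 x, G.1 x1 y1 x x = 0),
      [/\ forall y1 x2 y2 z, linear (fun x1 => G.2 x1 y1 x2 y2 z),
          forall x1 x2 y2 z, linear (fun y1 => G.2 x1 y1 x2 y2 z),
          forall x1 y1 y2 z, linear (fun x2 => G.2 x1 y1 x2 y2 z),
          forall x1 y1 x2 z, linear (fun y2 => G.2 x1 y1 x2 y2 z)
        & forall x1 y1 x2 y2, linear (fun z => G.2 x1 y1 x2 y2 z)]
    & (forall x x2 y2 z, G.2 x x x2 y2 z = 0) /\
      (forall x1 y1 x z, G.2 x1 y1 x x z = 0)].

(* The pair A = ([., .], [., ., .]) is a Lie Yamaguti structure on L. *)
Definition lie_yamaguti (A : maps1) : Prop :=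
  let b := A.1 in let w := A.2 in
  in_C1 A /\
  [/\ forall x y z, b (b x y) z + b (b y z) x + b (b z x) y
        + w x y z + w y z x + w z x y = 0,
      forall x y z t, w (b x y) z t + w (b y z) x t + w (b z x) y t = 0,
      forall x y z t, w x y (b z t) = b (w x y z) t + b z (w x y t)
    & forall x y z u t, w x y (w z u t) =
        w (w x y z) u t + w z (w x y u) t + w z u (w x y t)].

Definition compatible_lie_yamaguti (A1 A2 : maps1) : Prop :=
  let b1 := A1.1 in let w1 := A1.2 in
  let b2 := A2.1 in let w2 := A2.2 in
  [/\ lie_yamaguti A1, lie_yamaguti A2 &
  [/\ forall x y z,
        b2 (b1 x y) z + b2 (b1 y z) x + b2 (b1 z x) y
        + b1 (b2 x y) z + b1 (b2 y z) x + b1 (b2 z x) y = 0,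
      forall x y z t,
        w2 (b1 x y) z t + w2 (b1 y z) x t + w2 (b1 z x) y t
        + w1 (b2 x y) z t + w1 (b2 y z) x t + w1 (b2 z x) y t = 0,
      forall a b x y z,
        w2 a b (w1 x y z) + w1 a b (w2 x y z) =
        w2 (w1 a b x) y z + w2 x (w1 a b y) z + w2 x y (w1 a b z)
        + w1 (w2 a b x) y z + w1 x (w2 a b y) z + w1 x y (w2 a b z)
    & forall a b x y,
        w2 a b (b1 x y) + w1 a b (b2 x y) =
        b2 (w1 a b x) y + b2 x (w1 a b y)
        + b1 (w2 a b x) y + b1 x (w2 a b y)]].

Definition deform (A F : maps1) (t : K) : maps1 :=
  (fun x y => A.1 x y + t *: F.1 x y,
   fun x y z => A.2 x y z + t *: F.2 x y z).

(* The maps F_i = (mu_i, lambda_i) are only required to be multilinear here: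
   that they are alternating is a consequence. *)
Definition generates_deformation (A1 A2 F1 F2 : maps1) : Prop :=
  [/\ bilinear_map F1.1 /\ trilinear_map F1.2,
      bilinear_map F2.1 /\ trilinear_map F2.2
    & forall t : K, compatible_lie_yamaguti (deform A1 F1 t) (deform A2 F2 t)].

Definition circ (P Q : maps1) : maps2 :=
  (fun x1 y1 x2 y2 =>
     - P.2 x1 y1 (Q.1 x2 y2) + P.1 x2 (Q.2 x1 y1 y2) + P.1 (Q.2 x1 y1 x2) y2,
   fun x1 y1 x2 y2 x =>
     - P.2 x1 y1 (Q.2 x2 y2 x) + P.2 x2 y2 (Q.2 x1 y1 x)
     + P.2 x2 (Q.2 x1 y1 y2) x + P.2 (Q.2 x1 y1 x2) y2 x).

Definition add2 (G H : maps2) : maps2 :=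
  (fun x1 y1 x2 y2 => G.1 x1 y1 x2 y2 + H.1 x1 y1 x2 y2,
   fun x1 y1 x2 y2 x => G.2 x1 y1 x2 y2 x + H.2 x1 y1 x2 y2 x).

Definition bracket_LieY (P Q : maps1) : maps2 := add2 (circ P Q) (circ Q P).

Definition delta_c (A1 A2 : maps1) (F : maps1 * maps1) :
    maps2 * maps2 * maps2 :=
  (bracket_LieY A1 F.1,
   add2 (bracket_LieY A2 F.1) (bracket_LieY A1 F.2),
   bracket_LieY A2 F.2).

(* Vanishing is pointwise, i.e. equality with 0 up to extensionality. *)
Definition is_zero2 (G : maps2) : Prop :=
  (forall x1 y1 x2 y2, G.1 x1 y1 x2 y2 = 0) /\
  (forall x1 y1 x2 y2 x, G.2 x1 y1 x2 y2 x = 0).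

Definition cocycle23 (A1 A2 : maps1) (F : maps1 * maps1) : Prop :=
  let: (G1, G2, G3) := delta_c A1 A2 F in
  [/\ in_C1 F.1 /\ in_C1 F.2, is_zero2 G1, is_zero2 G2 & is_zero2 G3].

(* The formulas defining circ and delta_c on decomposable tensors are well
   defined: they yield multilinear maps, alternating in each pair. *)
Lemma in_C2_circ (P Q : maps1) : in_C1 P -> in_C1 Q -> in_C2 (circ P Q).
Proof.
move=> [[Pl Pr] P1a [Px Py Pz] P2a] [[Ql Qr] Q1a [Qx Qy Qz] Q2a].
have altD (f : L -> L -> L) : (forall y, linear (f^~ y)) ->
    (forall x, linear (f x)) -> (forall x, f x x = 0) ->
    forall x y, f x y + f y x = 0.
  move=> fl fr fa x y; have := fa (1 *: x + y).
  by rewrite (fl (1 *: x + y) 1) !fr !fa !scale1r add0r addr0.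
have l0 (f : L -> L) : linear f -> f 0 = 0.
  by move=> fl; have := fl (- 1) 0 0; rewrite scaleN1r oppr0 addr0 scaleN1r addNr.
have Pl' a y u v : P.1 (a *: u + v) y = a *: P.1 u y + P.1 v y.
  by rewrite Pl.
have Pr' a y u v : P.1 y (a *: u + v) = a *: P.1 y u + P.1 y v.
  by rewrite Pr.
have Px' a y z u v : P.2 (a *: u + v) y z = a *: P.2 u y z + P.2 v y z.
  by rewrite Px.
have Py' a y z u v : P.2 y (a *: u + v) z = a *: P.2 y u z + P.2 y v z.
  by rewrite Py.
have Pz' a y z u v : P.2 y z (a *: u + v) = a *: P.2 y z u + P.2 y z v.
  by rewrite Pz.
have Ql' a y u v : Q.1 (a *: u + v) y = a *: Q.1 u y + Q.1 v y.
  by rewrite Ql.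
have Qr' a y u v : Q.1 y (a *: u + v) = a *: Q.1 y u + Q.1 y v.
  by rewrite Qr.
have Qx' a y z u v : Q.2 (a *: u + v) y z = a *: Q.2 u y z + Q.2 v y z.
  by rewrite Qx.
have Qy' a y z u v : Q.2 y (a *: u + v) z = a *: Q.2 y u z + Q.2 y v z.
  by rewrite Qy.
have Qz' a y z u v : Q.2 y z (a *: u + v) = a *: Q.2 y z u + Q.2 y z v.
  by rewrite Qz.
have P1r0 x : P.1 x 0 = 0 by exact: l0 (Pr x).
have P1l0 y : P.1 0 y = 0 by exact: l0 (Pl y).
have Px0 y z : P.2 0 y z = 0 by exact: l0 (Px y z).
have Py0 x z : P.2 x 0 z = 0 by exact: l0 (Py x z).
have Pz0 x y : P.2 x y 0 = 0 by exact: l0 (Pz x y).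
have comb3 a (u1 v1 u2 v2 u3 v3 : L) :
    - (a *: u1 + v1) + (a *: u2 + v2) + (a *: u3 + v3)
    = a *: (- u1 + u2 + u3) + (- v1 + v2 + v3).
  by rewrite !scalerDr scalerN opprD (addrACA (- _)) (addrACA (- (a *: u1) + _)).
have comb4 a (u1 v1 u2 v2 u3 v3 u4 v4 : L) :
    - (a *: u1 + v1) + (a *: u2 + v2) + (a *: u3 + v3) + (a *: u4 + v4)
    = a *: (- u1 + u2 + u3 + u4) + (- v1 + v2 + v3 + v4).
  by rewrite comb3 addrACA -scalerDr.
have E := (Qx', Qy', Qz', Ql', Qr', Px', Py', Pz', Pl', Pr').
split=> /=.
- by split=> ? ? ? a u v; rewrite !E comb3.
- split=> [x x2 y2|x1 y1 x].
    by rewrite !Q2a P2a oppr0 P1r0 P1l0 !addr0.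
  by rewrite Q1a Pz0 oppr0 add0r altD.
- by split=> ? ? ? ? a u v; rewrite !E comb4.
- split=> [x x2 y2 z|x1 y1 x z].
    by rewrite !Q2a P2a oppr0 Py0 Px0 Pz0 !addr0.
  rewrite Q2a P2a Pz0 oppr0 !add0r (altD (fun u v => P.2 u v z)) //.
Qed.

Lemma in_C2_add2 (G H : maps2) : in_C2 G -> in_C2 H -> in_C2 (add2 G H).
Proof.
have lin (f g : L -> L) : linear f -> linear g -> linear (fun x => f x + g x).
  by move=> lf lg a u v; rewrite lf lg addrACA scalerDr.
move=> [[Ga Gb Gc Gd] [G0 G0'] [Ge Gf Gg Gh Gi] [G0'' G0''']].
move=> [[Ha Hb Hc Hd] [H0 H0'] [He Hf Hg Hh Hi] [H0'' H0''']].
split=> /=.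
- split=> x y z; [exact: (lin _ _ (Ga _ _ _) (Ha _ _ _))
    | exact: (lin _ _ (Gb _ _ _) (Hb _ _ _))
    | exact: (lin _ _ (Gc _ _ _) (Hc _ _ _))
    | exact: (lin _ _ (Gd _ _ _) (Hd _ _ _))].
- by split=> x y z; rewrite ?G0 ?G0' ?H0 ?H0' addr0.
- split=> x y z t; [exact: (lin _ _ (Ge _ _ _ _) (He _ _ _ _))
    | exact: (lin _ _ (Gf _ _ _ _) (Hf _ _ _ _))
    | exact: (lin _ _ (Gg _ _ _ _) (Hg _ _ _ _))
    | exact: (lin _ _ (Gh _ _ _ _) (Hh _ _ _ _))
    | exact: (lin _ _ (Gi _ _ _ _) (Hi _ _ _ _))].
- by split=> x y z t; rewrite ?G0'' ?G0''' ?H0'' ?H0''' addr0.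
Qed.

Lemma in_C2_delta_c (A1 A2 : maps1) (F : maps1 * maps1) :
  in_C1 A1 -> in_C1 A2 -> in_C1 F.1 -> in_C1 F.2 ->
  let: (G1, G2, G3) := delta_c A1 A2 F in
  [/\ in_C2 G1, in_C2 G2 & in_C2 G3].
Proof. by move=> *; split; do ?apply: in_C2_add2; apply: in_C2_circ. Qed.

End LieYamaguti.

(* Main.v *)
Require Import Defs.
From mathcomp Require Import all_boot all_algebra.

Set Implicit Arguments.
Unset Strict Implicit.
Unset Printing Implicit Defensive.

Import GRing.Theory.
Local Open Scope ring_scope.

(** The axioms (LY3)-(LY4) and (CY3)-(CY4) say that the structures
    [A1], [A2] satisfy [circ A1 A1 = 0], [circ A2 A2 = 0] and
    [[A1, A2]_LieY = 0]. For the deformed structures the left-hand sides are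
    quadratic polynomials in [t], vanishing for every [t]; their linear
    coefficients are the three components of [delta_c]. Comparing [t = 1] with
    [t = -1] isolates twice the linear coefficient. *)

Section Quadratic.
Variables (K : fieldType) (L : lmodType K).
Implicit Types (t : K) (a b c u v : L).

(** The coefficients are explicit arguments, so that [congr quad] compares two polynomials in [t]
    coefficientwise. *)
Definition quad t a b c : L := a + t *: b + t ^+ 2 *: c.

Lemma quadD t a b c a' b' c' :
  quad t a b c + quad t a' b' c' = quad t (a + a') (b + b') (c + c').
Proof. by rewrite /quad !scalerDr addrACA [a + _ + _]addrACA. Qed.

Lemma quadN t a b c : - quad t a b c = quad t (- a) (- b) (- c).
Proof. by rewrite /quad !opprD !scalerN. Qed.

Lemma quad_eq0_linear_coef (K2 : 2%:R != 0 :> K) a b c :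
  (forall t, quad t a b c = 0) -> b = 0.
Proof.
move=> q0; have : quad 1 a b c - quad (- 1) a b c = 0 by rewrite !q0 subr0.
rewrite /quad sqrrN expr1n !scale1r scaleN1r opprD addrACA subrr addr0.
rewrite opprB [b - a]addrC addrACA subrr add0r -mulr2n -scaler_nat.
by move/eqP; rewrite scaler_eq0 (negPf K2) => /eqP.
Qed.

Lemma linear_affine (f : L -> L) t u v :
  linear f -> f (u + t *: v) = f u + t *: f v.
Proof. by move=> lf; rewrite addrC lf addrC. Qed.

(** This expands [f + t g] at [u + t v], where [f] and [g] stand for one slot of the outer maps in
    [circ]. *)
Lemma quad_app (f g : L -> L) t u v : linear f -> linear g ->
  f (u + t *: v) + t *: g (u + t *: v) = quad t (f u) (f v + g u) (g v).
Proof.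
move=> lf lg; rewrite (linear_affine t u v lf) (linear_affine t u v lg) /quad.
by rewrite !scalerDr scalerA expr2 !addrA.
Qed.

End Quadratic.

Section Circ.
Variables (K : fieldType) (L : lmodType K).
Implicit Types A B F G : maps1 L.

(** Alternation is left out: for the deforming maps it is derived separately, in
    [deform_alternating]. *)
Definition multilinear1 F := bilinear_map F.1 /\ trilinear_map F.2.

Lemma in_C1_multilinear1 F : in_C1 F -> multilinear1 F.
Proof. by case. Qed.

(** Each term of [circ] feeds an inner map into one slot of an outer map, so [quad_app] applies slot
    by slot; the outer maps come from [A] and [F]. *)
Lemma circ_deform1 A B F G t x1 y1 x2 y2 :
  multilinear1 A -> multilinear1 F ->
  (circ (deform A F t) (deform B G t)).1 x1 y1 x2 y2 =
  quad t ((circ A B).1 x1 y1 x2 y2)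
    ((circ A G).1 x1 y1 x2 y2 + (circ F B).1 x1 y1 x2 y2)
    ((circ F G).1 x1 y1 x2 y2).
Proof.
move=> [[Al Ar] [_ _ A3]] [[Fl Fr] [_ _ F3]] /=.
rewrite (quad_app _ _ _ (A3 _ _) (F3 _ _)) (quad_app _ _ _ (Ar _) (Fr _)).
rewrite (quad_app _ _ _ (Al _) (Fl _)) quadN !quadD; congr quad.
by rewrite opprD (addrACA (- _)) [LHS]addrACA.
Qed.

Lemma circ_deform2 A B F G t x1 y1 x2 y2 x :
  multilinear1 A -> multilinear1 F ->
  (circ (deform A F t) (deform B G t)).2 x1 y1 x2 y2 x =
  quad t ((circ A B).2 x1 y1 x2 y2 x)
    ((circ A G).2 x1 y1 x2 y2 x + (circ F B).2 x1 y1 x2 y2 x)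
    ((circ F G).2 x1 y1 x2 y2 x).
Proof.
move=> [_ [A1 A2 A3]] [_ [F1 F2 F3]] /=.
rewrite (quad_app _ _ _ (A3 x1 y1) (F3 x1 y1)).
rewrite (quad_app _ _ _ (A3 x2 y2) (F3 x2 y2)).
rewrite (quad_app _ _ _ (A2 x2 x) (F2 x2 x)).
rewrite (quad_app _ _ _ (A1 y2 x) (F1 y2 x)).
rewrite quadN !quadD; congr quad.
by rewrite opprD (addrACA (- _)) (addrACA (- _ + _)) [LHS]addrACA.
Qed.

Lemma lie_yamaguti_circ A : lie_yamaguti A -> is_zero2 (circ A A).
Proof.
case=> _ [_ _ LY3 LY4]; split=> [x1 y1 x2 y2|x1 y1 x2 y2 x] /=.
  by rewrite LY3 -addrA [X in _ + X]addrC addNr.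
by rewrite (LY4 x1) (ACl (1*(4*3*2))) /= addNr.
Qed.

(** [CY4] yields the first component and [CY3] the second, once the two negated terms are gathered
    in front. *)
Lemma compatible_bracket A1 A2 :
  compatible_lie_yamaguti A1 A2 -> is_zero2 (bracket_LieY A1 A2).
Proof.
case=> _ _ [_ _ CY3 CY4]; split=> [x1 y1 x2 y2|x1 y1 x2 y2 x] /=.
  rewrite !addrA (ACl ((4*1)*(6*5*3*2))) /= -opprD.
  by rewrite CY4 addNr.
rewrite !addrA (ACl ((5*1)*(8*7*6*4*3*2))) /= -opprD.
by rewrite CY3 addNr.
Qed.

(** At [t = 1], [F] is the difference of two alternating structures. *)
Lemma deform_alternating A F : in_C1 A -> in_C1 (deform A F 1) ->
  multilinear1 F -> in_C1 F.
Proof.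
case=> _ A1 _ A2 [_ /= D1 _ D2] [bF tF]; split=> //.
  by move=> x; have := D1 x; rewrite A1 add0r scale1r.
by move=> x z; have := D2 x z; rewrite A2 add0r scale1r.
Qed.

Lemma circ_deform_linear_coef (K2 : 2%:R != 0 :> K) A F :
  multilinear1 A -> multilinear1 F ->
  (forall t, is_zero2 (circ (deform A F t) (deform A F t))) ->
  is_zero2 (bracket_LieY A F).
Proof.
move=> mA mF D0; split=> [x1 y1 x2 y2|x1 y1 x2 y2 x].
  apply: (@quad_eq0_linear_coef _ _ K2 ((circ A A).1 x1 y1 x2 y2) _
    ((circ F F).1 x1 y1 x2 y2)) => t.
  (* With [B = A] and [G = F], the linear coefficient is the bracket of [A] and [F]. *)
  by rewrite -[LHS]circ_deform1 //; apply: (D0 t).1.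
apply: (@quad_eq0_linear_coef _ _ K2 ((circ A A).2 x1 y1 x2 y2 x) _
  ((circ F F).2 x1 y1 x2 y2 x)) => t.
by rewrite -[LHS]circ_deform2 //; apply: (D0 t).2.
Qed.

Lemma bracket_deform_linear_coef (K2 : 2%:R != 0 :> K) A1 A2 F1 F2 :
  multilinear1 A1 -> multilinear1 A2 -> multilinear1 F1 -> multilinear1 F2 ->
  (forall t, is_zero2 (bracket_LieY (deform A1 F1 t) (deform A2 F2 t))) ->
  is_zero2 (add2 (bracket_LieY A2 F1) (bracket_LieY A1 F2)).
Proof.
move=> mA1 mA2 mF1 mF2 D0; split=> [x1 y1 x2 y2|x1 y1 x2 y2 x].
  apply: (@quad_eq0_linear_coef _ _ K2
    ((circ A1 A2).1 x1 y1 x2 y2 + (circ A2 A1).1 x1 y1 x2 y2) _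
    ((circ F1 F2).1 x1 y1 x2 y2 + (circ F2 F1).1 x1 y1 x2 y2)) => t.
  (* Zero is replaced by the deformed bracket; its linear coefficient consists of the same four
     [circ] terms as the goal, in another order. *)
  rewrite -[RHS]((D0 t).1 x1 y1 x2 y2).
  rewrite -[RHS]/((circ _ _).1 _ _ _ _ + (circ _ _).1 _ _ _ _).
  rewrite !circ_deform1 // quadD; congr quad.
  exact: (AC (2*2) ((3*2)*(1*4))).
apply: (@quad_eq0_linear_coef _ _ K2
  ((circ A1 A2).2 x1 y1 x2 y2 x + (circ A2 A1).2 x1 y1 x2 y2 x) _
  ((circ F1 F2).2 x1 y1 x2 y2 x + (circ F2 F1).2 x1 y1 x2 y2 x)) => t.
rewrite -[RHS]((D0 t).2 x1 y1 x2 y2 x).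
rewrite -[RHS]/((circ _ _).2 _ _ _ _ _ + (circ _ _).2 _ _ _ _ _).
rewrite !circ_deform2 // quadD; congr quad.
exact: (AC (2*2) ((3*2)*(1*4))).
Qed.

End Circ.

Theorem theorem5p1 (K : fieldType) (charK0 : [pchar K] =i pred0)
    (L : lmodType K)
    (br1 br2 : L -> L -> L) (tr1 tr2 : L -> L -> L -> L)
    (mu1 mu2 : L -> L -> L) (lam1 lam2 : L -> L -> L -> L) :
  compatible_lie_yamaguti (br1, tr1) (br2, tr2) ->
  generates_deformation (br1, tr1) (br2, tr2) (mu1, lam1) (mu2, lam2) ->
  cocycle23 (br1, tr1) (br2, tr2) ((mu1, lam1), (mu2, lam2)).
Proof.
move=> [[C1 _] [C2 _] _] [mF1 mF2 D].
have K2 : 2%:R != 0 :> K by have := charK0 2; rewrite !inE /= => ->.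
have mA1 := in_C1_multilinear1 C1; have mA2 := in_C1_multilinear1 C2.
have [[D1 _] [D2 _] _] := D 1.
split.
- by split; [exact: deform_alternating C1 D1 _ | exact: deform_alternating C2 D2 _].
- apply: circ_deform_linear_coef => // t.
  by apply: lie_yamaguti_circ; case: (D t).
(* The mixed component comes from compatibility, the outer two from each deformed structure
   alone. *)
- apply: bracket_deform_linear_coef => // t.
  exact: compatible_bracket (D t).
- apply: circ_deform_linear_coef => // t.
  by apply: lie_yamaguti_circ; case: (D t).
Qed.
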